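(* Let $\mathbf{k}$ be a field, $G$ an abelian group, $\lambda:G\times G\to\mathbf{k}^*$ a bicharacter, and $H$ a $(G,\lambda)$-graded Hopf algebra over $\mathbf{k}$ generated as an algebra by homogeneous primitive elements $a_1,\ldots,a_n$ with fixed positive integer degrees $d_1,\ldots,d_n$. If $H$ has only a finite number of hard super-letters, then $H$ is (left and right) Noetherian.
   Context: $(G,\lambda)$-graded Hopf algebra. $H=\bigoplus_{g\in G}H_g$ is a $G$-graded algebra and a $G$-graded coalgebra such that $\Delta:H\to H\otimes H$ and $\varepsilon:H\to\mathbf{k}$ are algebra homomorphisms, where $H\otimes H$ carries the multiplication $(a\otimes b)(c\otimes d)=\lambda(g_b,g_c)\,ac\otimes bd$ for homogeneous $b\in H_{g_b}$, $c\in H_{g_c}$, and such that there is a grading-preserving antipode (convolution inverse of the identity). An element $a$ is primitive if $\Delta(a)=a\otimes1+1\otimes a$. Words. Consider words in the alphabet $a_1,\ldots,a_n$, where $a_i\in H_{g_i}$, ordered lexicographically with $a_1>a_2>\cdots>a_n$: two words are compared from left to right at the first distinct letter, and a proper beginning of a word is greater than that word. For a word $u$ let $g_u\in G$ be obtained from $u$ by replacing each letter $a_i$ by $g_i$, and put $p_{uv}=\lambda(g_v,g_u)^{-1}$. A word $u$ with $m_i$ occurrences of $a_i$ has constitution $(m_1,\ldots,m_n)$ and degree $\deg(u)=m_1d_1+\cdots+m_nd_n$. Standard words. A nonempty word $u$ is standard if $u>u_2u_1$ for each factorization $u=u_1u_2$ into nonempty words. A nonassociative (fully bracketed) word $[u]$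 is standard if: (1) the word $u$ obtained by erasing brackets is standard; (2) if $[u]=[[v][w]]$ then $[v]$, $[w]$ are standard nonassociative words; (3) if $[u]=[[[v_1][v_2]][w]]$ then $v_2\le w$. By a theorem of Shirshov each standard word has a unique bracketing that is a standard nonassociative word (for $u$ of length $\ge 2$ it is $[[v][w]]$ with $u=vw$, $v,w$ standard and $v$ of least possible length). Super-letters and super-words. For a standard word $u$, the super-letter $[u]$ is the polynomial obtained from the standard nonassociative word $[u]$ by interpreting brackets as the skew commutator, defined on polynomials homogeneous in each variable by $[f,h]=fh-p_{uv}hf$, where $u,v$ are any words having the constitutions of $f,h$. It is evaluated as an element of $H$. Super-letters are indexed by standard words and ordered by $[u]>[v]\iff u>v$. A super-word is a (formal) word in super-letters; its degree is the sum of the degrees of its super-letters, with $\deg[u]=\deg(u)$. Hard super-letters. A super-letter $[u]$ is hard if in $H$ it is not a linear combination of super-words of degree $\deg(u)$ in super-letters less than $[u]$ and of super-words of degree less than $\deg(u)$. *)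

(* Defs.v *)
From HB Require Import structures.
From mathcomp Require Import all_boot all_order all_algebra.
From mathcomp Require Import boolp classical_sets cardinality.
From mathcomp Require Import freeg.

Set Implicit Arguments.
Unset Strict Implicit.
Unset Printing Implicit Defensive.

Import Order.TTheory GRing.Theory.
Local Open Scope classical_set_scope.
Local Open Scope ring_scope.
Local Open Scope quotient_scope.

Definition lspan (k : fieldType) (V : lmodType k) (S : set V) : set V :=
  [set x | exists m (c : 'I_m -> k) (v : 'I_m -> V),
     (forall i, S (v i)) /\ x = \sum_(i < m) c i *: v i].

Section LspanTheory.
Variables (k : fieldType) (V : lmodType k).
Implicit Types (S : set V) (x y : V).

Lemma lspan0 S : lspan S 0.
Proof. by exists 0, (fun=> 0), (fun=> 0); split=> [[]//|]; rewrite big_ord0. Qed.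

Lemma sub_lspan S x : S x -> lspan S x.
Proof.
by move=> Sx; exists 1, (fun=> 1), (fun=> x); split=> //; rewrite big_ord1 scale1r.
Qed.

Lemma lspanD S x y : lspan S x -> lspan S y -> lspan S (x + y).
Proof.
move=> [m [c [v [Sv ->]]]] [p [e [w [Sw ->]]]].
exists (m + p)%N, (fun i => match split i with inl j => c j | inr j => e j end),
  (fun i => match split i with inl j => v j | inr j => w j end).
split=> [i|]; first by case: (split i).
rewrite big_split_ord /=; congr (_ + _); apply: eq_bigr => i _.
  by case: split_ordP => j /eqP; rewrite ?eq_lshift ?eq_lrshift // => /eqP->.
by case: split_ordP => j /eqP; rewrite ?eq_rshift ?eq_rlshift // => /eqP->.
Qed.

Lemma lspanZ S a x : lspan S x -> lspan S (a *: x).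
Proof.
move=> [m [c [v [Sv ->]]]]; exists m, (fun i => a * c i), v; split=> //.
by rewrite scaler_sumr; apply: eq_bigr => i _; rewrite scalerA.
Qed.

Lemma lspan_min S (P : V -> Prop) : P 0 ->
  (forall a x y, P x -> P y -> P (a *: x + y)) -> (forall x, S x -> P x) ->
  forall x, lspan S x -> P x.
Proof.
move=> P0 PD SP x [m [c [v [Sv ->]]]]; elim/big_rec: _ => // i y _ Py.
exact/PD/Py/SP/Sv.
Qed.

End LspanTheory.

Definition bilinear_map (k : fieldType) (U V W : lmodType k) (f : U -> V -> W) :=
  (forall v, linear (f^~ v)) /\ (forall u, linear (f u)).

(* Tensor product over k: the quotient of the free module on U * V by the
   submodule spanned by the bilinearity relations. *)
Section Tensor.
Variables (k : fieldType) (U V : lmodType k).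

Local Notation free := {freeg (U * V)%type / k}.

Definition tensor_rel : set free :=
  [set D | (exists c u u' v,
              D = << (c *: u + u', v) >> - (c *: << (u, v) >> + << (u', v) >>)) \/
           (exists c u v v',
              D = << (u, c *: v + v') >> - (c *: << (u, v) >> + << (u, v') >>))].

Definition tensor_ker : {pred free} := [pred D | `[< lspan tensor_rel D >]].

Lemma tensor_kerP D : reflect (lspan tensor_rel D) (D \in tensor_ker).
Proof. exact: asboolP. Qed.

Lemma tensor_ker_zmod : zmod_closed tensor_ker.
Proof.
split=> [|x y /tensor_kerP Kx /tensor_kerP Ky]; apply/tensor_kerP.
  exact: lspan0.
by rewrite -scaleN1r; apply/lspanD/lspanZ.
Qed.

HB.instance Definition _ := GRing.isZmodClosed.Build free tensor_ker tensor_ker_zmod.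

Definition tensor := Quotient.quot tensor_ker.

HB.instance Definition _ := GRing.Zmodule.on tensor.

Definition tscale (c : k) (x : tensor) : tensor := \pi_tensor (c *: (repr x : free)).

Lemma pi_tensor_eq (x y : free) :
  \pi_tensor x = \pi_tensor y <-> lspan tensor_rel (x - y).
Proof.
split=> [/eqP|K].
  by rewrite -Quotient.idealrBE => K; exact/tensor_kerP.
by apply/eqP; rewrite -Quotient.idealrBE; exact/tensor_kerP.
Qed.

Lemma repr_tensor (x : free) : lspan tensor_rel (repr (\pi_tensor x) - x).
Proof. by apply/pi_tensor_eq; rewrite reprK. Qed.

Lemma pi_tscale c (x : free) : tscale c (\pi_tensor x) = \pi_tensor (c *: x).
Proof. by apply/pi_tensor_eq; rewrite -scalerBr; apply/lspanZ/repr_tensor. Qed.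

Lemma pi_tensorD (x y : free) : \pi_tensor (x + y) = \pi_tensor x + \pi_tensor y.
Proof. by rewrite !piE. Qed.

Lemma tensor_repr (x : tensor) : x = \pi_tensor (repr x).
Proof. by rewrite reprK. Qed.

Fact tscaleA a b x : tscale a (tscale b x) = tscale (a * b) x.
Proof. by rewrite (tensor_repr x) !pi_tscale scalerA. Qed.

Fact tscale1 : left_id 1 tscale.
Proof. by move=> x; rewrite (tensor_repr x) pi_tscale scale1r. Qed.

Fact tscaleDr : right_distributive tscale +%R.
Proof.
by move=> c x y; rewrite (tensor_repr x) (tensor_repr y) -pi_tensorD !pi_tscale scalerDr pi_tensorD.
Qed.

Fact tscaleDl x : {morph tscale^~ x : a b / a + b}.
Proof. by move=> a b; rewrite (tensor_repr x) !pi_tscale scalerDl pi_tensorD. Qed.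

HB.instance Definition _ :=
  GRing.Zmodule_isLmodule.Build k tensor tscaleA tscale1 tscaleDr tscaleDl.

Lemma pi_tensorZ c (x : free) : \pi_tensor (c *: x) = c *: (\pi_tensor x : tensor).
Proof. by rewrite -pi_tscale. Qed.

Definition tens (u : U) (v : V) : tensor := \pi_tensor << (u, v) >>.

Lemma tens_bilinear : bilinear_map tens.
Proof.
split=> [v c u u'|u c v v']; rewrite /tens -pi_tensorZ -pi_tensorD.
  by apply/pi_tensor_eq/sub_lspan; left; exists c, u, u', v.
by apply/pi_tensor_eq/sub_lspan; right; exists c, u, v, v'.
Qed.

(* The linear map induced by f; meaningful only when f is bilinear. *)
Definition tlift (W : lmodType k) (f : U -> V -> W) (x : tensor) : W :=
  fglift (fun p => f p.1 p.2) (repr x).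

Section Lift.
Variables (W : lmodType k) (f : U -> V -> W).
Hypothesis fbil : bilinear_map f.

Let F : free -> W := fglift (fun p => f p.1 p.2).

Let FB x y : F (x - y) = F x - F y.
Proof. exact: lift_is_additive. Qed.

Let F0 : F 0 = 0.
Proof. by rewrite -[X in F X](subrr 0) FB subrr. Qed.

Let FD x y : F (x + y) = F x + F y.
Proof. by rewrite -[y in LHS]opprK FB -[- y]sub0r FB F0 sub0r opprK. Qed.

Let FZ c x : F (c *: x) = c *: F x.
Proof.
rewrite -{2}[x]freeg_sumE [c *: x]/(fgscale c x) /fgscale.
rewrite !(big_morph F FD F0) scaler_sumr; apply: eq_bigr => p _.
by rewrite /F !liftU scalerA.
Qed.

Lemma tlift_pi (x : free) : tlift f (\pi_tensor x) = F x.
Proof.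
apply/eqP; rewrite -subr_eq0 -[tlift f _]/(F _) -scaleN1r -FZ -FD scaleN1r.
apply/eqP; move: (repr_tensor x).
apply: (lspan_min (P := fun y => F y = 0)) => // [a y z Fy Fz|y].
  by rewrite FD FZ Fy Fz scaler0 addr0.
case: fbil => fl fr [[c [u [u' [v ->]]]]|[c [u [v [v' ->]]]]].
  by rewrite -scaleN1r !(FD, FZ) /F !liftU !scale1r /= fl scaleN1r subrr.
by rewrite -scaleN1r !(FD, FZ) /F !liftU !scale1r /= fr scaleN1r subrr.
Qed.

Lemma tlift_linear : linear (tlift f).
Proof.
move=> c x y; rewrite (tensor_repr x) (tensor_repr y) -pi_tensorZ -pi_tensorD !tlift_pi.
by rewrite FD FZ.
Qed.

Lemma tliftE u v : tlift f (tens u v) = f u v.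
Proof. by rewrite tlift_pi /F liftU scale1r. Qed.

End Lift.

Lemma tens_span (x : tensor) : lspan [set y | exists u v, y = tens u v] x.
Proof.
rewrite (tensor_repr x) -[repr x]freeg_sumE; elim/big_rec: _ => [|p y _ Sy].
  by rewrite -(scale0r (0 : free)) pi_tensorZ scale0r; exact: lspan0.
rewrite pi_tensorD; apply: lspanD => //; case: p => u v.
rewrite (_ : << _ *g _ >> = coeff (u, v) (repr x) *: << (u, v) >>).
  by rewrite pi_tensorZ; apply/lspanZ/sub_lspan; exists u, v.
by apply/eqP/freeg_eqP => q; rewrite coeffZ !coeffU mul1r.
Qed.

End Tensor.


Section TensorMaps.
Variable k : fieldType.

Definition tmap (U V U' V' : lmodType k) (f : U -> U') (g : V -> V') :
    tensor U V -> tensor U' V' :=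
  tlift (fun u v => tens (f u) (g v)).

Definition tassoc (U V W : lmodType k) :
    tensor (tensor U V) W -> tensor U (tensor V W) :=
  tlift (fun x w => tlift (fun u v => tens u (tens v w)) x).

End TensorMaps.

(* The abelian group G is written additively. *)
Definition bicharacter (k : fieldType) (G : zmodType) (lam : G -> G -> k) :=
  [/\ forall g h, lam g h != 0,
      forall g g' h, lam (g + g') h = lam g h * lam g' h
    & forall g h h', lam g (h + h') = lam g h * lam g h'].

Section Graded.
Variables (k : fieldType) (G : zmodType).

(* H is the direct sum of the subspaces Hg g. *)
Definition is_grading (H : lmodType k) (Hg : G -> set H) :=
  [/\ forall g, submod_closed [in Hg g],
      forall x, exists (s : seq G) (c : G -> H),
        (forall g, Hg g (c g)) /\ x = \sum_(g <- s) c g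
    & forall (s : seq G) (c : G -> H), uniq s -> (forall g, Hg g (c g)) ->
        \sum_(g <- s) c g = 0 -> forall g, g \in s -> c g = 0].

Definition graded_algebra (H : algType k) (Hg : G -> set H) :=
  [/\ is_grading Hg, Hg 0 1
    & forall g h x y, Hg g x -> Hg h y -> Hg (g + h) (x * y)].

Definition tensor_component (H : lmodType k) (Hg : G -> set H) (g : G) :
    set (tensor H H) :=
  lspan [set z | exists g1 g2 x y,
    [/\ g = g1 + g2, Hg g1 x, Hg g2 y & z = tens x y]].

Definition graded_coalgebra (H : lmodType k) (Hg : G -> set H)
    (Delta : H -> tensor H H) (eps : H -> k) :=
  [/\ is_grading Hg,
      forall x, tassoc (tmap Delta id (Delta x)) = tmap id Delta (Delta x),
      forall x, tlift (fun y z => eps y *: z) (Delta x) = x /\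
                tlift (fun y z => eps z *: y) (Delta x) = x,
      forall g x, Hg g x -> tensor_component Hg g (Delta x)
    & forall g x, Hg g x -> g != 0 -> eps x = 0].

Variable lam : G -> G -> k.

(* Since H is the sum of its components, these conditions determine mul. *)
Definition is_twisted_mul (H : algType k) (Hg : G -> set H)
    (mul : tensor H H -> tensor H H -> tensor H H) :=
  bilinear_map mul /\
  (forall gb gc a b c d, Hg gb b -> Hg gc c ->
     mul (tens a b) (tens c d) = lam gb gc *: tens (a * c) (b * d)).

Record graded_hopf (H : algType k) := GradedHopf {
  component : G -> set H;
  tmul : tensor H H -> tensor H H -> tensor H H;
  coproduct : {linear H -> tensor H H};
  counit : {lrmorphism H -> k^o};
  antipode : {linear H -> H};
  hopf_algebra : graded_algebra component;
  hopf_coalgebra : graded_coalgebra component coproduct counit;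
  hopf_tmul : is_twisted_mul component tmul;
  coproduct1 : coproduct 1 = tens 1 1;
  coproductM : forall x y, coproduct (x * y) = tmul (coproduct x) (coproduct y);
  antipode_graded : forall g x, component g x -> component g (antipode x);
  antipode_left : forall x,
    tlift (fun y z => antipode y * z) (coproduct x) = counit x *: 1;
  antipode_right : forall x,
    tlift (fun y z => y * antipode z) (coproduct x) = counit x *: 1
}.

Definition primitive (H : algType k) (hopf : graded_hopf H) (x : H) :=
  coproduct hopf x = tens x 1 + tens 1 x.

End Graded.

Definition generates_algebra (k : fieldType) (H : algType k) (I : Type) (a : I -> H) :=
  forall S : set H, subalg_closed [in S] -> (forall i, S (a i)) -> forall x, S x.

(* The letter a_i is represented by i; since a_0 > a_1 > ... and a proper
   beginning of a word is greater than the word, the order on words is the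
   reverse of the usual lexicographic order. *)
Definition word_lt n (u v : seq 'I_n) : bool :=
  ((v : seqlexi 'I_n) < (u : seqlexi 'I_n))%O.
Definition word_le n (u v : seq 'I_n) : bool :=
  ((v : seqlexi 'I_n) <= (u : seqlexi 'I_n))%O.

Definition standard_word n (u : seq 'I_n) :=
  u <> [::] /\
  forall u1 u2, u = u1 ++ u2 -> u1 <> [::] -> u2 <> [::] -> word_lt (u2 ++ u1) u.

Inductive nonassoc_word n :=
  | Letter of 'I_n
  | Bracket of nonassoc_word n & nonassoc_word n.

Fixpoint erase n (t : nonassoc_word n) : seq 'I_n :=
  match t with
  | Letter i => [:: i]
  | Bracket v w => erase v ++ erase w
  end.

Fixpoint standard_nonassoc n (t : nonassoc_word n) : Prop :=
  standard_word (erase t) /\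
  match t with
  | Letter _ => True
  | Bracket v w =>
      [/\ standard_nonassoc v, standard_nonassoc w
        & if v is Bracket _ v2 then word_le (erase v2) (erase w) else True]
  end.

Record super_letter n := SuperLetter {
  sl_nonassoc :> nonassoc_word n;
  sl_standard : standard_nonassoc sl_nonassoc
}.

Definition sl_lt n (s t : super_letter n) := word_lt (erase s) (erase t).

Section SuperWords.
Variables (k : fieldType) (G : zmodType) (lam : G -> G -> k) (H : algType k).
Variables (n : nat) (a : 'I_n -> H) (g : 'I_n -> G) (d : 'I_n -> nat).

Definition word_weight (u : seq 'I_n) : G := \sum_(i <- u) g i.

Definition skew_coef (u v : seq 'I_n) : k :=
  (lam (word_weight v) (word_weight u))^-1.

(* The value in H of a nonassociative word under the skew commutator; the
   polynomials of v and w have the constitutions of the words erase v, erase w. *)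
Fixpoint skew_value (t : nonassoc_word n) : H :=
  match t with
  | Letter i => a i
  | Bracket v w =>
      skew_value v * skew_value w
      - skew_coef (erase v) (erase w) *: (skew_value w * skew_value v)
  end.

Definition word_degree (u : seq 'I_n) : nat :=
  (\sum_(i < n) count_mem i u * d i)%N.

Definition sl_degree (s : super_letter n) : nat := word_degree (erase s).

Definition sw_degree (W : seq (super_letter n)) : nat :=
  (\sum_(s <- W) sl_degree s)%N.

Definition sw_value (W : seq (super_letter n)) : H := \prod_(s <- W) skew_value s.

Definition hard (s : super_letter n) :=
  ~ lspan [set x | exists W : seq (super_letter n), x = sw_value W /\
             ((sw_degree W = sl_degree s /\ all (fun t => sl_lt t s) W) \/
              (sw_degree W < sl_degree s)%N)]
          (skew_value s).

End SuperWords.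

Section Noetherian.
Variable R : nzRingType.

Definition left_ideal (I : set R) :=
  [/\ I 0, forall x y, I x -> I y -> I (x + y) & forall r x, I x -> I (r * x)].
Definition right_ideal (I : set R) :=
  [/\ I 0, forall x y, I x -> I y -> I (x + y) & forall r x, I x -> I (x * r)].

Definition acc (P : set R -> Prop) :=
  forall I : nat -> set R, (forall m, P (I m)) -> (forall m, I m `<=` I m.+1) ->
    exists N, forall m, (N <= m)%N -> I m = I N.

Definition left_noetherian := acc left_ideal.
Definition right_noetherian := acc right_ideal.

End Noetherian.

(* Main.v *)
Require Import Defs.
From HB Require Import structures.
From mathcomp Require Import all_boot all_order all_algebra.
From mathcomp Require Import boolp classical_sets cardinality.
From mathcomp Require Import zify.

(** Let [u] > [v] be super-letters. By the skew Jacobi identity, [[u][v]] is a linear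
    combination of super-words of the same constitution in super-letters at most
    [uv], hence less than [u]. Rewriting non-hard super-letters by their
    definition, one may take these super-words in hard super-letters less than
    [u], up to super-words of lower degree. So H is spanned by the words in the
    finitely many hard super-letters, and these commute up to a nonzero scalar
    and words that are lower in the order comparing first degrees and then, from
    the greatest hard super-letter downwards, numbers of occurrences. This order
    is total up to permutation of letters, well-founded and compatible with
    concatenation, so a one-sided ideal is determined, among those containing it,
    by its set of leading words, and by Dickson's lemma increasing chains of
    such sets are stationary. *)

Set Implicit Arguments.
Unset Strict Implicit.
Unset Printing Implicit Defensive.

Import Order.TTheory GRing.Theory.
Local Open Scope classical_set_scope.
Local Open Scope ring_scope.

(** * Standard words *)

Local Notation "u <l v" := ((u : seqlexi _) < (v : seqlexi _))%O (at level 70).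
Local Notation "u <=l v" := ((u : seqlexi _) <= (v : seqlexi _))%O (at level 70).

(** * Lexicographic comparison and concatenation *)

Section Lexicographic.
Variables (disp : Order.disp_t) (T : orderType disp).
Implicit Types (u v w z : seq T).

(** Comparison decided at a position inside both words. Without the prefix case of the full order,
    it survives appending arbitrary words on the right. *)
Fixpoint branches_below u v : bool :=
  match u, v with
  | x :: u', y :: v' => (x < y)%O || (x == y) && branches_below u' v'
  | _, _ => false
  end.

Lemma branches_below_cat u v w z :
  branches_below u v -> branches_below (u ++ w) (v ++ z).
Proof.
elim: u v => [|x u IHu] [|y v] //= /orP[->//|/andP[-> /IHu ->]].
by rewrite orbT.
Qed.

Lemma branches_below_lt u v : branches_below u v -> u <l v.
Proof.
elim: u v => [|x u IHu] [|y v] //= /orP[xy|/andP[/eqP-> /IHu uv]].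
  by rewrite Order.SeqLexiOrder.ltxi_cons (ltW xy) (lt_geF xy).
by rewrite Order.SeqLexiOrder.ltxi_cons lexx.
Qed.

Lemma lexi_lt_cases u v :
  u <l v -> branches_below u v \/ exists2 z, z <> [::] & v = u ++ z.
Proof.
elim: u v => [|x u IHu] [|y v] //=; first by right; exists (y :: v).
rewrite Order.SeqLexiOrder.ltxi_cons; case: (ltgtP x y) => //= [_|xy].
  by left.
rewrite {}xy => /IHu.
by case=> [->|[z z0 ->]]; [left|right; exists z].
Qed.

Lemma lexi_lt_branches u v : u <l v -> (size v <= size u)%N -> branches_below u v.
Proof.
case/lexi_lt_cases => // -[z z0 ->].
by case: z z0 => // t z _; rewrite size_cat /=; lia.
Qed.

Lemma lexi_lt_cat u v w z : u <l v -> (size v <= size u)%N -> u ++ w <l v ++ z.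
Proof.
by move=> uv sz; apply/branches_below_lt/branches_below_cat/lexi_lt_branches.
Qed.

Lemma lexi_lt_cat2l w u v : (w ++ u <l w ++ v) = (u <l v).
Proof. by elim: w => //= x w IHw; rewrite Order.SeqLexiOrder.ltxi_cons lexx. Qed.

Lemma lexi_le_cat2l w u v : (w ++ u <=l w ++ v) = (u <=l v).
Proof. by elim: w => //= x w IHw; rewrite Order.SeqLexiOrder.lexi_cons lexx. Qed.

Lemma lexi_lt_prefix u z : z <> [::] -> u <l u ++ z.
Proof. by case: z => // t z _; rewrite -[X in X <l _]cats0 lexi_lt_cat2l. Qed.

End Lexicographic.

(** * Shirshov's standard words and the uniqueness of their bracketings *)

Section StandardWords.
Variable n : nat.
Implicit Types (u v w x : seq 'I_n).

(** Suppose [v] is lexicographically below [uv]. If they differ inside [v], the rotation [vu] is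
    below [uv], against standardness. Otherwise [uv = vy] with [y] as long as [u]; then [uv < vu]
    gives [y < u], so the rotation [yv] is below [uv]. *)
Lemma standard_word_lt_suffix u v :
  standard_word (u ++ v) -> u <> [::] -> v <> [::] -> u ++ v <l v.
Proof.
move=> [_ std] u0 v0; have := std _ _ erefl u0 v0; rewrite /word_lt => uv.
have szu : (0 < size u)%N by case: u u0 {std uv}.
rewrite ltNge le_eqVlt; apply/negP => /orP[/eqP/(congr1 (fun w : seq 'I_n => size w))|].
  by rewrite size_cat; lia.
case/lexi_lt_cases => [/branches_below_cat vlt|[y y0 vE]].
  have := branches_below_lt (vlt u [::]); rewrite cats0 => /(lt_trans uv).
  by rewrite ltxx.
have szE : size y = size u.
  by have := congr1 (fun w : seq 'I_n => size w) vE; rewrite !size_cat /=; lia.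
move: uv; rewrite vE lexi_lt_cat2l => yu.
have := std v y vE v0 y0; rewrite /word_lt => /lt_trans /(_ (lexi_lt_cat v v yu _)).
by rewrite szE leqnn ltxx => /(_ isT).
Qed.

Lemma lt_suffix_standard_word u : u <> [::] ->
  (forall u1 u2, u = u1 ++ u2 -> u1 <> [::] -> u2 <> [::] -> u <l u2) ->
  standard_word u.
Proof.
move=> u0 H; split=> // u1 u2 uE u10 u20.
rewrite /word_lt -[X in X <l _]cats0; apply: lexi_lt_cat (H _ _ uE u10 u20) _.
by rewrite uE size_cat; lia.
Qed.

(** If [v = u ++ z], cancelling [u] leaves the comparison of [v] with its own suffix [z]. *)
Lemma standard_cat_lt u v : standard_word u -> standard_word v -> u <l v -> u ++ v <l v.
Proof.
move=> [u0 _] stdv uv; case: (lexi_lt_cases uv) => [blw|[z z0 vE]].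
  by rewrite -[X in _ <l X]cats0; apply/branches_below_lt/branches_below_cat.
by rewrite {2}vE lexi_lt_cat2l vE; apply: standard_word_lt_suffix => //; rewrite -vE.
Qed.

(** A suffix starting properly inside [u] begins with a proper suffix of [u], which is shorter and
    lexicographically larger than [u]. A suffix starting in [v] is at least [v], which exceeds
    [u ++ v]. *)
Lemma standard_word_cat u v :
  standard_word u -> standard_word v -> u <l v -> standard_word (u ++ v).
Proof.
move=> stdu stdv uv; have [u0 _] := stdu; have [v0 _] := stdv.
have uvv := standard_cat_lt stdu stdv uv.
apply: lt_suffix_standard_word => [|u1 u2 E u10 u20]; first by case: (u) u0.
have u2E : u2 = drop (size u1) (u ++ v) by rewrite E drop_size_cat.
have szu1 : (0 < size u1)%N by case: (u1) u10.
move: u2E; rewrite drop_cat; case: ltnP => szu u2E.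
  have u0' : drop (size u1) u <> [::] by move/(congr1 size); rewrite size_drop /=; lia.
  have t0' : take (size u1) u <> [::] by move/(congr1 size); rewrite size_take szu /=; lia.
  rewrite u2E; apply: lexi_lt_cat; last by rewrite size_drop; lia.
  rewrite -{1}(cat_take_drop (size u1) u).
  by apply: standard_word_lt_suffix => //; rewrite cat_take_drop.
apply: lt_le_trans uvv _; rewrite u2E.
have [->|k0] := posnP (size u1 - size u); first by rewrite drop0.
set k := (_ - _)%N in k0 u2E *.
have kv : (k < size v)%N by rewrite ltnNge; apply/negP => kv; apply: u20; rewrite u2E drop_oversize.
have t0 : take k v <> [::] by move/(congr1 size); rewrite size_take kv /=; lia.
have d0 : drop k v <> [::] by rewrite -u2E.
rewrite ltW // -{1}(cat_take_drop k v); apply: standard_word_lt_suffix => //.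
by rewrite cat_take_drop.
Qed.

Implicit Types (t s : nonassoc_word n).

Lemma size_erase_gt0 t : (0 < size (erase t))%N.
Proof. by elim: t => //= t IHt s _; rewrite size_cat; lia. Qed.

Lemma erase_neq0 t : erase t <> [::].
Proof. by have := size_erase_gt0 t; case: (erase t). Qed.

Lemma standard_erase t : standard_nonassoc t -> standard_word (erase t).
Proof. by case: t => [i|t s] []. Qed.

Lemma lt_drop_standard u k : standard_word u -> (0 < k < size u)%N -> u <l drop k u.
Proof.
move=> stdu /andP[k0 ku]; rewrite -{1}(cat_take_drop k u).
apply: standard_word_lt_suffix; first by rewrite cat_take_drop.
  by move/(congr1 size); rewrite size_take ku /=; lia.
by move/(congr1 size); rewrite size_drop /=; lia.
Qed.

Lemma le_drop_standard u k : standard_word u -> (k < size u)%N -> u <=l drop k u.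
Proof.
have [->|k0] := posnP k; first by rewrite drop0.
by move=> stdu ku; apply/ltW/lt_drop_standard; rewrite // k0.
Qed.

(* The right factor being the least proper suffix, a standard word determines
   its bracketing. *)
Lemma standard_right_min t s k :
  standard_nonassoc (Bracket t s) -> (0 < k < size (erase t ++ erase s))%N ->
  erase s <=l drop k (erase t ++ erase s).
Proof.
elim: t s k => [i|t1 IHt1 t2 _] s k [_ [stdt stds le_ts]] /andP[k0 k_lt];
  rewrite drop_cat; case: ltnP => kt; try by move: kt; rewrite /=; lia.
1,3: by apply: le_drop_standard; [exact: standard_erase | move: k_lt; rewrite size_cat; lia].
have k_in : (0 < k < size (erase t1 ++ erase t2))%N by rewrite k0.
(* Condition (3) puts [erase s] at most [erase t2], which by induction is at most each proper suffix
   of [erase t]; appending [erase s] to that suffix only increases it. *)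
apply/ltW/(le_lt_trans le_ts)/(le_lt_trans (IHt1 _ _ stdt k_in)).
exact/lexi_lt_prefix/erase_neq0.
Qed.

(** Uniqueness in Shirshov's theorem: the two right factors are proper suffixes of one word, and by
    minimality each is at most the other. *)
Lemma standard_nonassoc_inj t s :
  standard_nonassoc t -> standard_nonassoc s -> erase t = erase s -> t = s.
Proof.
elim: t s => [i|t1 IHt1 t2 IHt2] [j|s1 s2].
- by move=> _ _ [->].
- move=> _ _ /(congr1 size) /=; rewrite size_cat.
  by have := size_erase_gt0 s1; have := size_erase_gt0 s2; lia.
- move=> _ _ /(congr1 size) /=; rewrite size_cat.
  by have := size_erase_gt0 t1; have := size_erase_gt0 t2; lia.
move=> stdt stds E; have [_ [stdt1 stdt2 _]] := stdt; have [_ [stds1 stds2 _]] := stds.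
have min_le (a1 a2 b1 b2 : nonassoc_word n) : standard_nonassoc (Bracket a1 a2) ->
    erase a1 ++ erase a2 = erase b1 ++ erase b2 -> erase a2 <=l erase b2.
  move=> stda Eab; have := standard_right_min stda (k := size (erase b1)).
  rewrite Eab drop_size_cat // size_cat => -> //.
  by have := size_erase_gt0 b1; have := size_erase_gt0 b2; lia.
have E2 : erase t2 = erase s2.
  apply: (@le_anti _ (seqlexi 'I_n)).
  by rewrite (min_le _ _ _ _ stdt E) (min_le _ _ _ _ stds (esym E)).
move/eqP: (E); rewrite /= E2 eqseq_cat; last first.
  by have := congr1 size E; rewrite /= E2 !size_cat => /addIn.
by case/andP => /eqP E1 _; rewrite (IHt1 s1) // (IHt2 s2).
Qed.

Lemma super_letter_inj (s t : super_letter n) : erase s = erase t -> s = t.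
Proof.
case: s t => [s stds] [t stdt] /= /(standard_nonassoc_inj stds stdt) E.
by case: t / E stdt => stdt; congr SuperLetter; exact: Prop_irrelevance.
Qed.

End StandardWords.

(** * Skew commutators of super-letters *)

Section Spans.
Variables (k : fieldType) (V : lmodType k).
Implicit Types (S T : set V) (x y : V).

Lemma lspanN S x : lspan S x -> lspan S (- x).
Proof. by rewrite -scaleN1r; exact: lspanZ. Qed.

Lemma lspanB S x y : lspan S x -> lspan S y -> lspan S (x - y).
Proof. by move=> Sx /lspanN; exact: lspanD. Qed.

Lemma lspan_subset S T x : (forall y, S y -> lspan T y) -> lspan S x -> lspan T x.
Proof.
move=> ST; apply: (lspan_min (P := lspan T)) => //; first exact: lspan0.
by move=> c y z Ty; apply/lspanD/lspanZ.
Qed.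

End Spans.

Lemma lspanM (k : fieldType) (A : algType k) (S T U : set A) :
  (forall x y, S x -> T y -> lspan U (x * y)) ->
  forall x y, lspan S x -> lspan T y -> lspan U (x * y).
Proof.
move=> STU x y Sx Ty.
apply: (lspan_min (P := fun x => lspan U (x * y))) Sx; first by rewrite mul0r; exact: lspan0.
  by move=> c z z' ? ?; rewrite mulrDl -scalerAl; apply/lspanD => //; exact: lspanZ.
move=> {}x Sx; apply: (lspan_min (P := fun y => lspan U (x * y))) Ty.
- by rewrite mulr0; exact: lspan0.
- by move=> c z z' ? ?; rewrite mulrDr -scalerAr; apply/lspanD => //; exact: lspanZ.
by move=> z; exact: STU.
Qed.

(** This is [[x,y],z] = [x,[y,z]] - p12 y[x,z] + p23 [x,z]y; the outer brackets carry the products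
    of scalars that multiplicativity of [skew_coef] produces. *)
Lemma skew_jacobi (k : fieldType) (A : algType k) (x y z : A) (p12 p13 p23 : k) :
  (x * y - p12 *: (y * x)) * z - (p13 * p23) *: (z * (x * y - p12 *: (y * x))) =
  x * (y * z - p23 *: (z * y)) - (p12 * p13) *: ((y * z - p23 *: (z * y)) * x)
  - p12 *: (y * (x * z - p13 *: (z * x))) + p23 *: ((x * z - p13 *: (z * x)) * y).
Proof.
rewrite !(mulrBl, mulrBr) -?(scalerAl, scalerAr) !scalerBr !scalerA !mulrA.
rewrite (mulrC p23 p13) (mulrC (p13 * p23) p12) !mulrA !opprB !addrA.
set A1 := x * y * z; set A2 := p12 *: (y * x * z); set A3 := (p13 * p23) *: _.
set A4 := (p12 * p13 * p23) *: _; set A5 := p23 *: _; set A6 := (p12 * p13) *: _.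
rewrite subrK; congr (_ - _).
by rewrite (addrAC A1 (- A5)) (addrAC (A1 + A4) (- A5)) subrK addrAC.
Qed.

Section SuperWords.
Variables (k : fieldType) (G : zmodType) (lam : G -> G -> k).
Hypothesis lam_bichar : bicharacter lam.
Variables (H : algType k) (n : nat) (a : 'I_n -> H) (g : 'I_n -> G).

Local Notation p := (skew_coef lam g).
Local Notation value := (skew_value lam a g).
Local Notation sw_val := (sw_value lam a g).

Implicit Types (u v w b c : seq 'I_n) (s t : super_letter n) (W : seq (super_letter n)).

Definition sw_erase W : seq 'I_n := flatten [seq erase (sl_nonassoc s) | s <- W].

Lemma sw_erase_cat W W' : sw_erase (W ++ W') = sw_erase W ++ sw_erase W'.
Proof. by rewrite /sw_erase map_cat flatten_cat. Qed.

Lemma sw_value_cat W W' : sw_val (W ++ W') = sw_val W * sw_val W'.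
Proof. by rewrite /sw_value big_cat. Qed.

Lemma sw_erase1 s : sw_erase [:: s] = erase s.
Proof. exact: cats0. Qed.

Lemma sw_value1 s : sw_val [:: s] = value s.
Proof. by rewrite /sw_value big_seq1. Qed.

Lemma word_weight_cat u v : word_weight g (u ++ v) = word_weight g u + word_weight g v.
Proof. exact: big_cat. Qed.

Lemma perm_word_weight u v : perm_eq u v -> word_weight g u = word_weight g v.
Proof. exact: perm_big. Qed.

Lemma skew_coef_neq0 u v : p u v != 0.
Proof. by rewrite invr_eq0; case: lam_bichar. Qed.

Lemma skew_coef_catl u v w : p (u ++ v) w = p u w * p v w.
Proof.
by rewrite /skew_coef word_weight_cat; case: lam_bichar => _ _ ->; rewrite invfM.
Qed.

Lemma skew_coef_catr u v w : p u (v ++ w) = p u v * p u w.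
Proof.
by rewrite /skew_coef word_weight_cat; case: lam_bichar => _ -> _; rewrite invfM.
Qed.

Lemma skew_coef_nilr u : p u [::] = 1.
Proof.
by apply: (mulfI (skew_coef_neq0 u [::])); rewrite -skew_coef_catr mulr1.
Qed.

(* [b <=l erase s] says that [s] is at most [b] in the order on super-letters,
   which reverses the lexicographic one. *)
Definition bounded_words c b : set H :=
  [set x | exists W, [/\ x = sw_val W, perm_eq (sw_erase W) c
                      & all (fun s => b <=l erase s) W]].

Local Notation bspan c b := (lspan (bounded_words c b)).

Lemma bspan_perm c c' b x : perm_eq c c' -> bspan c b x -> bspan c' b x.
Proof.
move=> cc'; apply: lspan_subset => y [W [-> Wc Wb]]; apply: sub_lspan.
by exists W; split=> //; exact: perm_trans cc'.
Qed.

Lemma bspan_le c b b' x : b' <=l b -> bspan c b x -> bspan c b' x.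
Proof.
move=> b'b; apply: lspan_subset => y [W [-> Wc Wb]]; apply: sub_lspan.
by exists W; split=> //; apply: sub_all Wb => s; exact: le_trans.
Qed.

Lemma bspanM c c' b x y : bspan c b x -> bspan c' b y -> bspan (c ++ c') b (x * y).
Proof.
apply: lspanM => {}x {}y [W [-> Wc Wb]] [W' [-> Wc' Wb']]; apply: sub_lspan.
exists (W ++ W'); rewrite sw_value_cat all_cat Wb Wb'; split=> //.
by rewrite sw_erase_cat perm_cat.
Qed.

Lemma bspan_letter s b : b <=l erase s -> bspan (erase s) b (value s).
Proof.
by move=> bs; apply: sub_lspan; exists [:: s]; rewrite sw_value1 sw_erase1 /= bs.
Qed.

(* [fun y => x y - p y x] is a skew derivation. *)
Lemma bspan_skew_sw x u b (Q : pred (super_letter n)) W :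
  (forall s, Q s -> b <=l erase s) ->
  (forall s, Q s ->
     bspan (u ++ erase s) b (x * value s - p u (erase s) *: (value s * x))) ->
  all Q W ->
  bspan (u ++ sw_erase W) b (x * sw_val W - p u (sw_erase W) *: (sw_val W * x)).
Proof.
move=> Qb Qx; elim: W => [_|s W IHW] /=.
  rewrite /sw_value big_nil skew_coef_nilr mulr1 mul1r scale1r subrr.
  exact: lspan0.
move=> /andP[Qs QW]; rewrite -cat1s sw_value_cat sw_erase_cat sw_value1.
rewrite sw_erase1 skew_coef_catr.
set y := value s; set z := sw_val W; set c := sw_erase W.
have -> : x * (y * z) - (p u (erase s) * p u c) *: (y * z * x) =
    (x * y - p u (erase s) *: (y * x)) * z
    + p u (erase s) *: (y * (x * z - p u c *: (z * x))).
  rewrite mulrBl mulrBr scalerBr -scalerAl -scalerAr scalerA !mulrA addrA.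
  by rewrite subrK.
apply: lspanD; last apply: lspanZ.
  rewrite catA; apply: bspanM; first exact: Qx.
  by apply: sub_lspan; exists W; split=> //; apply: sub_all QW.
apply: (bspan_perm (c := erase s ++ u ++ c)); first by rewrite perm_catCA.
by apply: bspanM; [apply/bspan_letter/Qb | exact: IHW].
Qed.

(** [Q] holds the letters whose bracket with [x] is under control. Membership in [Q] is to follow
    from the constitution [c] and the bound [b'], so that [Q] may also limit lengths. *)
Lemma bspan_skew x u c b b' y (Q : pred (super_letter n)) :
  (forall s, Q s -> b <=l erase s) ->
  (forall s, Q s ->
     bspan (u ++ erase s) b (x * value s - p u (erase s) *: (value s * x))) ->
  (forall W, perm_eq (sw_erase W) c -> all (fun s => b' <=l erase s) W -> all Q W) ->
  bspan c b' y -> bspan (u ++ c) b (x * y - p u c *: (y * x)).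
Proof.
move=> Qb Qx Qc; apply: (lspan_min
  (P := fun y => bspan (u ++ c) b (x * y - p u c *: (y * x)))).
- by rewrite mulr0 mul0r scaler0 subrr; exact: lspan0.
- move=> e z z' Pz Pz'; rewrite mulrDr mulrDl scalerDr opprD addrACA.
  rewrite -scalerAr -scalerAl scalerA (mulrC (p _ _)) -scalerA -scalerBr.
  by apply: lspanD => //; exact: lspanZ.
move=> _ [W [-> Wc Wb']].
apply: (bspan_perm (c := u ++ sw_erase W)); first by rewrite perm_cat2l.
have <- : p u (sw_erase W) = p u c by rewrite /skew_coef (perm_word_weight Wc).
exact: bspan_skew_sw Qb Qx (Qc _ Wc Wb').
Qed.

Lemma size_letter_sw W : all (fun s => (size (erase s) <= size (sw_erase W))%N) W.
Proof.
elim: W => //= s W IHW; rewrite -cat1s sw_erase_cat sw_erase1.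
rewrite size_cat leq_addr /=; apply: sub_all IHW => t /leq_trans; apply.
exact: leq_addl.
Qed.

(* By induction on the length of [u v] and then on the bracketing of [u]: if
   [[u1 u2] v] is not a standard bracketing then [u2 > v] and the skew Jacobi
   identity applies. *)
Lemma skew_bracket_bspan (t s : nonassoc_word n) :
  standard_nonassoc t -> standard_nonassoc s -> erase t <l erase s ->
  bspan (erase t ++ erase s) (erase t ++ erase s)
    (value t * value s - p (erase t) (erase s) *: (value s * value t)).
Proof.
have [m] := ubnP (size (erase t) + size (erase s)).
elim: m t s => // m IHm t; elim: t => [i|t1 IHt1 t2 _] s szm stdt stds ts.
  have std : standard_nonassoc (Bracket (Letter i) s).
    by split=> //; exact: standard_word_cat (standard_erase stdt) (standard_erase stds) ts.
  (* The bracket is a standard one, so the skew commutator is the value of a single super-letter. *)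
  exact: (bspan_letter (s := SuperLetter std)).
have stdts : standard_word (erase (Bracket t1 t2) ++ erase s).
  exact: standard_word_cat (standard_erase stdt) (standard_erase stds) ts.
case: (leP (erase s : seqlexi _) (erase t2)) => [st2|t2s].
  have std : standard_nonassoc (Bracket (Bracket t1 t2) s) by split.
  exact: (bspan_letter (s := SuperLetter std)).
have [stdt1t2 [stdt1 stdt2 _]] := stdt.
rewrite /= in szm ts stdt1t2 stdts *.
set u1 := erase t1 in IHt1 szm ts stdt1t2 stdts *.
set u2 := erase t2 in szm ts stdt1t2 stdts t2s *.
set v := erase s in szm ts t2s stdts *.
have szu1 : (0 < size u1)%N := size_erase_gt0 t1.
have szu2 : (0 < size u2)%N := size_erase_gt0 t2.
have szv : (0 < size v)%N := size_erase_gt0 s.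
rewrite !size_cat in szm.
have u1_lt : u1 <l u1 ++ u2 by apply: lexi_lt_prefix; exact: erase_neq0.
have u12_lt : u1 ++ u2 <l u2 by apply: standard_word_lt_suffix => //; exact: erase_neq0.
have u12v_lt w : (u1 ++ u2) ++ v <l u2 ++ w.
  by apply: lexi_lt_cat => //; rewrite size_cat leq_addl.
rewrite skew_coef_catl skew_jacobi.
(* The outer induction applies to [u1], [v], a shorter pair; its bound [u1 v] is good enough since
   [u2 < v] gives [u2 v < v]. *)
have span1 : bspan (u1 ++ v) ((u1 ++ u2) ++ v)
    (value t1 * value s - p u1 v *: (value s * value t1)).
  apply: (bspan_le (b := u1 ++ v)).
    rewrite -catA lexi_le_cat2l; apply: ltW.
    by apply: standard_cat_lt => //; apply: standard_erase.
  apply: IHm => //; first by rewrite -/u1 -/v; lia.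
  exact: lt_trans ts.
have span2 : bspan u2 ((u1 ++ u2) ++ v) (value t2).
  apply: (bspan_letter (s := SuperLetter stdt2)); apply/ltW.
  by rewrite -[X in _ <l X]cats0.
apply: lspanD; first apply: lspanB.
- rewrite -catA -skew_coef_catr.
  (* The commutator of [u2] and [v] expands in letters [w] at least [u2 v] and no longer than it.
     The length of [u1 w] need not drop, so the commutators with [u1] come from the inner induction
     on the bracketing. *)
  apply: (bspan_skew (b' := u2 ++ v)
    (Q := fun r => (u2 ++ v <=l erase r) && (size (erase r) <= size (u2 ++ v))%N)).
  + move=> w /andP[+ _]; apply: le_trans; apply/ltW.
    by rewrite catA.
  + move=> w /andP[le_w sz_w]; apply: (bspan_le (b := u1 ++ erase w)).
      by rewrite lexi_le_cat2l.
    apply: IHt1 => //; [|exact: sl_standard|].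
      by rewrite size_cat in sz_w; lia.
    apply: lt_le_trans le_w; apply: lt_trans (u12v_lt v).
    by rewrite -catA; apply: lexi_lt_prefix; case: (u2) szu2.
  + move=> W Wc Wb; rewrite all_predI Wb /= -(perm_size Wc).
    exact: size_letter_sw.
  by apply: IHm => //; rewrite -/u2 -/v; lia.
- apply: lspanZ; apply: (bspan_perm (c := u2 ++ u1 ++ v)); last exact: bspanM.
  by rewrite -catA perm_catCA.
apply: lspanZ; apply: (bspan_perm (c := (u1 ++ v) ++ u2)); last exact: bspanM.
by rewrite -!catA perm_cat2l perm_catC.
Qed.

End SuperWords.

(** * Reduction to hard super-letters *)

(** There are finitely many words of length at most [m], so one can induct on the number of those
    below [u]. *)
Lemma bounded_word_ind (T : finType) (r : rel (seq T)) (m : nat) (P : seq T -> Prop) :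
  irreflexive r -> transitive r ->
  (forall u, (size u <= m)%N ->
     (forall v, (size v <= m)%N -> r v u -> P v) -> P u) ->
  forall u, (size u <= m)%N -> P u.
Proof.
move=> r_irr r_trans IH u.
pose below v : pred (m.-bseq T) := [pred w : m.-bseq T | r w v].
have [N] := ubnP #|below u|; elim: N u => // N IHN u; rewrite ltnS => uN um.
apply: IH => // v vm vu; apply: IHN => //; apply: leq_trans uN.
apply/proper_card/properP; split.
  by apply/fintype.subsetP => w; rewrite !inE => /r_trans; apply.
by exists (Bseq vm); rewrite inE //= r_irr.
Qed.

Section HardReduction.
Variables (k : fieldType) (G : zmodType) (lam : G -> G -> k).
Variables (H : algType k) (n : nat) (a : 'I_n -> H) (g : 'I_n -> G) (d : 'I_n -> nat).
Hypothesis d_pos : forall i, (0 < d i)%N.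

Local Notation value := (skew_value lam a g).
Local Notation sw_val := (sw_value lam a g).

Implicit Types (u v : seq 'I_n) (s t : super_letter n) (W : seq (super_letter n)).
Implicit Types (P Q : pred (super_letter n)).

Lemma word_degreeE u : word_degree d u = (\sum_(i <- u) d i)%N.
Proof.
elim: u => [|i u IHu]; rewrite /word_degree ?big_nil ?big_cons -?IHu.
  by rewrite big1.
under eq_bigr do rewrite /= mulnDl.
rewrite big_split /= (bigD1 i) //= eqxx mul1n big1 ?addn0 // => j /negPf.
by rewrite eq_sym => ->.
Qed.

Lemma word_degree_cat u v : word_degree d (u ++ v) = (word_degree d u + word_degree d v)%N.
Proof. by rewrite !word_degreeE big_cat. Qed.

Lemma perm_word_degree u v : perm_eq u v -> word_degree d u = word_degree d v.
Proof. by rewrite !word_degreeE; exact: perm_big. Qed.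

Lemma size_word_degree u : (size u <= word_degree d u)%N.
Proof. by rewrite word_degreeE -sum1_size; apply: leq_sum. Qed.

Lemma sl_degree_gt0 s : (0 < sl_degree d s)%N.
Proof. exact: leq_trans (size_erase_gt0 s) (size_word_degree _). Qed.

Lemma sw_degree_erase W : sw_degree d W = word_degree d (sw_erase W).
Proof.
elim: W => [|s W IHW]; first by rewrite /sw_degree big_nil word_degreeE big_nil.
by rewrite /sw_degree big_cons -cat1s sw_erase_cat sw_erase1 word_degree_cat -IHW.
Qed.

Lemma sw_degree_cat W W' : sw_degree d (W ++ W') = (sw_degree d W + sw_degree d W')%N.
Proof. exact: big_cat. Qed.

Lemma sw_degree1 s : sw_degree d [:: s] = sl_degree d s.
Proof. exact: big_seq1. Qed.

Lemma sl_degree_sw W : all (fun s => (sl_degree d s <= sw_degree d W)%N) W.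
Proof.
elim: W => //= s W IHW; rewrite -cat1s sw_degree_cat sw_degree1 leq_addr /=.
by apply: sub_all IHW => t /leq_trans; apply; exact: leq_addl.
Qed.

Definition is_hard s := `[< hard lam a g d s >].

(** [P] constrains only super-words of degree exactly [D]; those of lower degree are free, as in the
    definition of hardness. *)
Definition hard_words D P : set H :=
  [set x | exists W, [/\ x = sw_val W, all is_hard W
    & (sw_degree d W < D)%N \/ sw_degree d W = D /\ all P W]].

Local Notation hspan D P := (lspan (hard_words D P)).

Lemma hspan_sub D P Q x : subpred P Q -> hspan D P x -> hspan D Q x.
Proof.
move=> PQ; apply: lspan_subset => y [W [-> Wh WD]]; apply: sub_lspan.
exists W; split=> //; case: WD => [|[WD WP]]; first by left.
by right; split=> //; exact: sub_all WP.
Qed.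

Lemma hspan_lt D E P Q x : (D < E)%N -> hspan D P x -> hspan E Q x.
Proof.
move=> DE; apply: lspan_subset => y [W [-> Wh WD]]; apply: sub_lspan.
exists W; split=> //; left.
by case: WD => [|[->]] // /leq_trans; apply; exact: ltnW.
Qed.

Lemma hspanM D E P x y : hspan D P x -> hspan E P y -> hspan (D + E) P (x * y).
Proof.
apply: lspanM => {}x {}y [W [-> Wh WD]] [W' [-> Wh' WD']]; apply: sub_lspan.
exists (W ++ W'); rewrite sw_value_cat sw_degree_cat !all_cat Wh Wh'; split=> //.
case: WD WD' => [WD|[WD ->]] [WD'|[WD' ->]]; try by left; lia.
by right; split; [lia|].
Qed.

Lemma hspan_sw P Q W :
  (forall s, Q s -> hspan (sl_degree d s) P (value s)) -> all Q W ->
  hspan (sw_degree d W) P (sw_val W).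
Proof.
move=> QP; elim: W => [_|s W IHW] /=.
  by apply: sub_lspan; exists [::]; split=> //; right.
move=> /andP[Qs QW]; rewrite -cat1s sw_degree_cat sw_value_cat sw_value1 sw_degree1.
by apply: hspanM; [exact: QP | exact: IHW].
Qed.

(** Induction on the degree, then on the order of super-letters, which is well-founded here because
    positive degrees bound the lengths of the words. *)
Lemma hspan_letter s :
  hspan (sl_degree d s) (fun t => word_le (erase t) (erase s)) (value s).
Proof.
have [m] := ubnP (sl_degree d s); elim: m s => // m IHm s sm.
have size_m r : (sl_degree d r < m.+1)%N -> (size (erase r) <= m)%N.
  exact: leq_trans (size_word_degree _).
have lt_irr : irreflexive (@word_lt n) by move=> u; exact: ltxx.
have lt_trans : transitive (@word_lt n) by move=> v u w /[swap]; exact: lt_trans.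
suff by_word u : (size u <= m)%N -> forall r : super_letter n, erase r = u ->
    (sl_degree d r < m.+1)%N ->
    hspan (sl_degree d r) (fun t => word_le (erase t) (erase r)) (value r).
  exact: by_word (size_m s sm) s erefl sm.
move: u {s sm}; apply: (bounded_word_ind (m := m) lt_irr lt_trans) => u _ IHu s su sm.
rewrite -{u}su in IHu.
have [/asboolP s_hard|/asboolP/contrapT] := boolP (is_hard s).
  apply: sub_lspan; exists [:: s]; split; rewrite ?sw_value1 //= ?andbT.
    exact/asboolP.
  by right; split; [exact: sw_degree1 | exact: lexx].
apply: lspan_subset => _ [W [-> [[WD Ws]|WD]]]; last first.
  (* In a super-word of lower degree all letters have lower degree; no order bound has to be
     kept. *)
  apply: (hspan_lt (P := predT) _ WD); apply: (hspan_sw (Q := fun t => (sl_degree d t < m)%N)).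
    by move=> t tm; apply: hspan_sub (IHm _ tm).
  by apply: sub_all (sl_degree_sw W) => t tW; lia.
rewrite -WD; apply: (hspan_sw (Q := fun t => sl_lt t s && (sl_degree d t < m.+1)%N)).
  move=> t /andP[ts tm].
  apply: (hspan_sub (P := fun r => word_le (erase r) (erase t))).
    by move=> r /=; rewrite /word_le; apply: le_trans; exact: ltW.
  exact: IHu (size_m t tm) ts t erefl tm.
rewrite all_predI Ws /=; apply: sub_all (sl_degree_sw W) => t tW.
by rewrite ltnS; apply: leq_trans tW _; rewrite WD.
Qed.

End HardReduction.

(** * Algebras spanned by skew-commuting words *)

Section Dickson.

(** [phi] picks, again and again, a position where [f] is minimal on the remaining tail. *)
Lemma nondecreasing_subsequence (f : nat -> nat) :
  exists phi : nat -> nat, {homo phi : i j / (i < j)%N} /\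
    {homo f \o phi : i j / (i <= j)%N}.
Proof.
have minf p : exists q, (p <= q)%N /\ forall r, (p <= r)%N -> (f q <= f r)%N.
  suff min_below m q : (p <= q)%N -> (f q < m)%N ->
      exists q, (p <= q)%N /\ forall r, (p <= r)%N -> (f q <= f r)%N.
    exact: min_below (leqnn p) (ltnSn _).
  elim: m q => // m IHm q pq fq.
  have [[r [pr rq]]|nr] := pselect (exists r, (p <= r)%N /\ (f r < f q)%N).
    by apply: (IHm r) => //; exact: leq_trans rq _.
  exists q; split=> // r pr; rewrite leqNgt; apply/negP => rq.
  by apply: nr; exists r.
have [h hP] := choice minf; pose phi i := iter i (fun q => h q.+1) (h 0%N).
have phiS i : phi i.+1 = h (phi i).+1 by [].
have phi_lt : {homo phi : i j / (i < j)%N}.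
  apply: homo_ltn; first by move=> ? ? ?; exact: ltn_trans.
  by move=> i; rewrite phiS; have [] := hP (phi i).+1.
have phi_min i r : (phi i <= r)%N -> (f (phi i) <= f r)%N.
  case: i => [|i] ir; first by have [_ ->] := hP 0%N.
  rewrite phiS; have [hi] := hP (phi i).+1; apply.
  exact: leq_trans hi ir.
exists phi; split=> // i j; rewrite leq_eqVlt => /orP[/eqP->//|ij].
exact/phi_min/ltnW/phi_lt.
Qed.

Lemma nondecreasing_subsequences (T : eqType) (f : T -> nat -> nat) (s : seq T) :
  exists phi : nat -> nat, {homo phi : i j / (i < j)%N} /\
    {in s, forall t, {homo f t \o phi : i j / (i <= j)%N}}.
Proof.
elim: s => [|t s [phi [phi_lt phi_s]]]; first by exists id; split.
have [psi [psi_lt psi_t]] := nondecreasing_subsequence (f t \o phi).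
exists (phi \o psi); split=> [i j /psi_lt/phi_lt //|u].
rewrite inE => /predU1P[->|us] i j ij; first exact: psi_t.
apply: (phi_s u us); move: ij; rewrite leq_eqVlt => /orP[/eqP-> //|ij].
exact/ltnW/psi_lt.
Qed.

(** Along a common subsequence the multiplicity of every letter is nondecreasing, so its first word
    is a sub-multiset of the second and [X] is the complement. *)
Lemma dickson (T : finType) (W : nat -> seq T) :
  exists i j X, (i < j)%N /\ perm_eq (X ++ W i) (W j).
Proof.
have [phi [phi_lt phi_T]] :=
  nondecreasing_subsequences (fun t i => count_mem t (W i)) (enum T).
have /count_subseqP[s s_sub Ws] : forall t, (count_mem t (W (phi 0)) <= count_mem t (W (phi 1)))%N.
  by move=> t; apply: (phi_T t) => //; rewrite mem_enum.
have [X WX] := perm_to_subseq s_sub.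
exists (phi 0%N), (phi 1%N), X; split; first exact: phi_lt.
by rewrite perm_sym (permPl WX) perm_catC perm_cat2l perm_sym.
Qed.

End Dickson.

(** * Leading words and ascending chains of one-sided ideals *)

Section LeadingWords.
Variables (k : fieldType) (R : algType k) (N : nat).
Variables (x : 'I_N -> R) (delta : 'I_N -> nat).
Hypothesis delta_gt0 : forall i, (0 < delta i)%N.

Implicit Types (U V W X A B : seq 'I_N) (i j : 'I_N) (y z : R) (I J : set R).

Definition monomial W : R := \prod_(i <- W) x i.

Definition weight W : nat := \sum_(i <- W) delta i.

(** A degree-lexicographic order on commutative monomials, letters of small index being compared
    first. *)
Definition word_below U V : bool :=
  (weight U < weight V)%N || (weight U == weight V) &&
  [exists i, (count_mem i U < count_mem i V)%N &&
     [forall j : 'I_N, (j < i)%N ==> (count_mem j U == count_mem j V)]].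

Lemma word_belowP U V : reflect
  ((weight U < weight V)%N \/ weight U = weight V /\
     exists i, (count_mem i U < count_mem i V)%N /\
       forall j, (j < i)%N -> count_mem j U = count_mem j V)
  (word_below U V).
Proof.
apply: (iffP orP) => [[|/andP[/eqP UV /existsP[i /andP[iUV /forallP iP]]]]|].
- by left.
- by right; split=> //; exists i; split=> // j ji; apply/eqP/(implyP (iP j)).
case=> [|[UV [i [iUV iP]]]]; [by left | right].
rewrite UV eqxx; apply/existsP; exists i; rewrite iUV; apply/forallP => j.
by apply/implyP => ji; rewrite iP.
Qed.

Lemma monomial_cat U V : monomial (U ++ V) = monomial U * monomial V.
Proof. exact: big_cat. Qed.

Lemma weight_cat U V : weight (U ++ V) = (weight U + weight V)%N.
Proof. exact: big_cat. Qed.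

Lemma perm_weight U V : perm_eq U V -> weight U = weight V.
Proof. exact: perm_big. Qed.

Lemma size_weight W : (size W <= weight W)%N.
Proof. by rewrite -sum1_size; apply: leq_sum. Qed.

Lemma word_below_irr : irreflexive word_below.
Proof.
by move=> W; apply/negP => /word_belowP[|[_ [i []]]]; rewrite ltnn.
Qed.

Lemma word_below_trans : transitive word_below.
Proof.
move=> V U W /word_belowP UV /word_belowP VW; apply/word_belowP.
case: UV VW => [UV|[UV [i [iUV iP]]]] [VW|[VW [j [jVW jP]]]]; try by left; lia.
right; split; first by rewrite UV.
have [ij|ji|/val_inj ij] := ltngtP i j.
- exists i; rewrite -(jP i ij); split=> // l li; rewrite iP // jP //.
  exact: ltn_trans ij.
- exists j; rewrite (iP j ji); split=> // l lj; rewrite iP ?jP //.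
  exact: ltn_trans ji.
exists i; split; first by rewrite {2}ij in jVW *; apply: ltn_trans iUV _; rewrite ij.
by move=> l li; rewrite iP // jP // -ij.
Qed.

Lemma word_below_total U V : [\/ word_below U V, perm_eq U V | word_below V U].
Proof.
have [UV|VU|UV] := ltngtP (weight U) (weight V).
- by constructor 1; apply/word_belowP; left.
- by constructor 3; apply/word_belowP; left.
have [/existsP[i0 i0P]|] := boolP [exists i, count_mem i U != count_mem i V].
  case: (@arg_minnP _ i0 (fun i => count_mem i U != count_mem i V) val i0P) => i iUV imin.
  have iP j : (j < i)%N -> count_mem j U = count_mem j V.
    by move=> ji; apply/eqP; apply: contraTT ji => /imin; rewrite -leqNgt.
  case: ltngtP iUV => // iUV _; [constructor 1|constructor 3];
    apply/word_belowP; right; split=> //; exists i; split=> // j ji; exact/esym/iP.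
rewrite negb_exists => /forallP UVc; constructor 2; apply/allP => i _ /=.
by have := UVc i; rewrite negbK.
Qed.

Lemma word_below_cat A B U V : word_below U V -> word_below (A ++ U ++ B) (A ++ V ++ B).
Proof.
move=> /word_belowP UV; apply/word_belowP; rewrite !weight_cat.
case: UV => [UV|[UV [i [iUV iP]]]]; [by left; lia | right; split; first by lia].
exists i; rewrite !count_cat; split; first by lia.
by move=> j ji; rewrite !count_cat iP.
Qed.

Lemma perm_word_below U U' V V' : perm_eq U U' -> perm_eq V V' ->
  word_below U V = word_below U' V'.
Proof.
move=> UU' VV'; rewrite /word_below (perm_weight UU') (perm_weight VV').
congr (_ || _ && _); apply: eq_existsb => i.
rewrite !(seq.permP UU') !(seq.permP VV'); congr (_ && _); apply: eq_forallb => j.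
by rewrite !(seq.permP UU') !(seq.permP VV').
Qed.

(** Positive weights bound the length by the weight, so only finitely many words lie below a given
    one. *)
Lemma word_below_ind (P : seq 'I_N -> Prop) :
  (forall W, (forall V, word_below V W -> P V) -> P W) -> forall W, P W.
Proof.
move=> IH W; have [m] := ubnP (weight W); elim: m W => // m IHm W Wm.
have Wsz : (size W <= m)%N := leq_trans (size_weight W) Wm.
move: W Wsz Wm; apply: (bounded_word_ind (m := m) word_below_irr word_below_trans).
move=> U _ IHU Um; apply: IH => V VU.
have Vm : (weight V < m.+1)%N by case/word_belowP: VU => [|[->//]]; lia.
exact: IHU (leq_trans (size_weight V) Vm) VU Vm.
Qed.

Definition monomials (Q : pred (seq 'I_N)) : set R :=
  [set y | exists2 W, Q W & y = monomial W].

Local Notation lower W := (lspan (monomials (word_below^~ W))).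
Local Notation lower_eq W :=
  (lspan (monomials (fun V => perm_eq V W || word_below V W))).

Lemma perm_lower U V y : perm_eq U V -> lower U y -> lower V y.
Proof.
move=> UV; apply: lspan_subset => _ [W WU ->]; apply: sub_lspan; exists W => //.
by rewrite -(perm_word_below (perm_refl W) UV).
Qed.

Lemma lower_mul A B U y : lower U y ->
  lower (A ++ U ++ B) (monomial A * y * monomial B).
Proof.
move=> Uy; apply: (lspan_min
  (P := fun y => lower (A ++ U ++ B) (monomial A * y * monomial B))) Uy.
- by rewrite mulr0 mul0r; exact: lspan0.
- move=> c z z' ? ?; rewrite mulrDr mulrDl -scalerAr -scalerAl.
  by apply: lspanD => //; exact: lspanZ.
move=> _ [W WU ->]; apply: sub_lspan; exists (A ++ W ++ B).
  exact: word_below_cat.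
by rewrite !monomial_cat mulrA.
Qed.

(** A substitute for the leading term: the monomials may be linearly dependent, so one only asks for
    some word of [Q] that bounds an expression of [y]. *)
Lemma lspan_dominated Q y : lspan (monomials Q) y ->
  y = 0 \/ exists2 W, Q W & lower_eq W y.
Proof.
apply: (lspan_min (P := fun y => y = 0 \/ exists2 W, Q W & lower_eq W y)).
- by left.
- move=> c z z' [->|[U QU Uz]] [->|[V QV Vz']].
  + by left; rewrite scaler0 addr0.
  + by right; exists V => //; rewrite scaler0 add0r.
  + by right; exists U => //; rewrite addr0; exact: lspanZ.
  have widen A B w : perm_eq A B || word_below A B -> lower_eq A w -> lower_eq B w.
    move=> AB; apply: lspan_subset => _ [W WA ->]; apply: sub_lspan; exists W => //.
    case/orP: AB => AB.
      by rewrite -(perm_word_below (perm_refl W) AB) -(permPr AB).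
    case/orP: WA => WA; apply/orP; right; last exact: word_below_trans AB.
    by rewrite (perm_word_below WA (perm_refl B)).
  right; have [UV|UV|VU] := word_below_total U V.
  + exists V => //; apply: lspanD => //; apply: lspanZ.
    by apply: widen Uz; rewrite UV orbT.
  + by exists V => //; apply: lspanD => //; apply: lspanZ; apply: widen Uz; rewrite UV.
  exists U => //; apply: lspanD; first exact: lspanZ.
  by apply: widen Vz'; rewrite VU orbT.
move=> _ [W QW ->]; right; exists W => //; apply: sub_lspan; exists W => //.
by rewrite perm_refl.
Qed.

Hypothesis x_gen : forall y, lspan (monomials predT) y.
Hypothesis x_comm : forall i j, (i < j)%N -> exists2 c : k,
  c != 0 & lower [:: i; j] (x i * x j - c *: (x j * x i)).

Definition skew_equiv U V :=
  perm_eq U V /\ exists2 c : k, c != 0 & lower U (monomial U - c *: monomial V).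

Lemma skew_equiv_refl U : skew_equiv U U.
Proof.
split=> //; exists 1; first exact: oner_neq0.
by rewrite scale1r subrr; exact: lspan0.
Qed.

Lemma skew_equiv_trans V U W : skew_equiv U V -> skew_equiv V W -> skew_equiv U W.
Proof.
move=> [UV [c c0 Uc]] [VW [e e0 Ve]]; split; first exact: perm_trans VW.
exists (c * e); first by rewrite mulf_neq0.
have -> : monomial U - (c * e) *: monomial W = 
  (monomial U - c *: monomial V) + c *: (monomial V - e *: monomial W).
  by rewrite scalerBr scalerA addrA subrK.
by apply: lspanD => //; apply: lspanZ; apply: perm_lower Ve; rewrite perm_sym.
Qed.

Lemma skew_equiv_cat A B U V : skew_equiv U V -> skew_equiv (A ++ U ++ B) (A ++ V ++ B).
Proof.
move=> [UV [c c0 Uc]]; split; first by rewrite perm_cat2l perm_cat2r.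
exists c => //; have := lower_mul A B Uc.
by rewrite mulrBr mulrBl -scalerAr -scalerAl !monomial_cat !mulrA.
Qed.

Lemma skew_equiv_swap i j : skew_equiv [:: i; j] [:: j; i].
Proof.
have ijC : perm_eq [:: i; j] [:: j; i].
    by rewrite -[X in perm_eq X _]/([:: i] ++ [:: j]) perm_catC.
have monE l l' : monomial [:: l; l'] = x l * x l'.
  by rewrite /monomial !big_cons big_nil mulr1.
split=> //; rewrite !monE; have [ij|ji|/val_inj->] := ltngtP i j.
- exact: x_comm.
- have [c c0 ji_lower] := x_comm ji; exists c^-1; first by rewrite invr_eq0.
  rewrite -opprB; apply: lspanN; apply: (perm_lower (U := [:: j; i])).
    by rewrite perm_sym.
  have -> : c^-1 *: (x j * x i) - x i * x j = c^-1 *: (x j * x i - c *: (x i * x j)).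
    by rewrite scalerBr scalerA mulVf // scale1r.
  exact: lspanZ.
exists 1; first exact: oner_neq0.
by rewrite scale1r subrr; exact: lspan0.
Qed.

Lemma skew_equiv_move i U V : skew_equiv (i :: U ++ V) (U ++ i :: V).
Proof.
elim: U => [|j U IHU]; first exact: skew_equiv_refl.
have := skew_equiv_cat [:: j] [::] IHU; rewrite !cats0; apply: skew_equiv_trans.
exact: (skew_equiv_cat [::] (U ++ V) (skew_equiv_swap i j)).
Qed.

(** After matching the remaining letters by induction, the head of [U] is moved to its place in [V]
    by adjacent swaps, each costing a nonzero scalar and lower terms. *)
Lemma perm_skew_equiv U V : perm_eq U V -> skew_equiv U V.
Proof.
elim: U V => [|i U IHU] V UV.
  by rewrite perm_sym in UV; rewrite (perm_nilP UV); exact: skew_equiv_refl.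
have iV : i \in V by rewrite -(perm_mem UV) mem_head.
case/path.splitPr: iV UV => V1 V2 UV.
have UV12 : perm_eq U (V1 ++ V2).
  by rewrite -(perm_cons i) (permPl UV) -cat1s perm_catCA.
apply: skew_equiv_trans (skew_equiv_move i V1 V2).
by have := skew_equiv_cat [:: i] [::] (IHU _ UV12); rewrite !cats0.
Qed.

(** An element may have several leading words; even 0 has leading word [W] when [monomial W] is a
    combination of lower monomials. *)
Definition leading I W := exists2 y, I y & lower W (y - monomial W).

Definition subspace I :=
  [/\ I 0, forall y z, I y -> I z -> I (y + z) & forall c y, I y -> I (c *: y)].

Lemma perm_leading I U V : subspace I -> perm_eq U V -> leading I U -> leading I V.
Proof.
move=> [_ _ IZ] UV [y Iy Uy]; have [_ [c c0 Uc]] := perm_skew_equiv UV.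
exists (c^-1 *: y); first exact: IZ.
have -> : c^-1 *: y - monomial V =
    c^-1 *: ((y - monomial U) + (monomial U - c *: monomial V)).
  by rewrite addrA subrK scalerBr scalerA mulVf // scale1r.
by apply/lspanZ/(perm_lower UV)/lspanD.
Qed.

(** Division: a multiple of an element of [I] with leading word [W] cancels the top part of an
    element of [J] bounded by [W], and the difference is handled by induction on [W]. *)
Lemma leading_subset I J : subspace I -> subspace J -> I `<=` J ->
  (forall W, leading J W -> leading I W) -> J `<=` I.
Proof.
move=> [I0 ID IZ] [J0 JD JZ] IJ lead_JI.
suff dom W : forall y, J y -> lower_eq W y -> I y.
  by move=> y Jy; have [->//|[W _ Wy]] := lspan_dominated (x_gen y); exact: dom Wy.
elim/word_below_ind: W => W IHW y Jy Wy.
have low z : J z -> lower W z -> I z.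
  by move=> Jz /lspan_dominated[->//|[V VW Vz]]; exact: IHW Vz.
(* All permutations of [W] in an expression of [y] are collected into one multiple of
   [monomial W]. *)
have [c Wc] : exists c, lower W (y - c *: monomial W).
  apply: (lspan_min (P := fun y => exists c, lower W (y - c *: monomial W))) Wy.
  - by exists 0; rewrite scale0r subrr; exact: lspan0.
  - move=> c z z' [e ez] [e' ez']; exists (c * e + e').
    rewrite scalerDl opprD addrACA -scalerA -scalerBr.
    by apply: lspanD => //; exact: lspanZ.
  move=> _ [V /orP[VW|VW] ->]; last first.
    by exists 0; rewrite scale0r subr0; apply: sub_lspan; exists V.
  have [_ [c _ Vc]] := perm_skew_equiv VW; exists c.
  exact: perm_lower Vc.
have [c0|c0] := eqVneq c 0.
  by apply: low => //; move: Wc; rewrite c0 scale0r subr0.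
have [z Iz Wz] : leading I W.
  apply: lead_JI; exists (c^-1 *: y); first exact: JZ.
  have -> : c^-1 *: y - monomial W = c^-1 *: (y - c *: monomial W).
    by rewrite scalerBr scalerA mulVf // scale1r.
  exact: lspanZ.
rewrite -[y](subrK (c *: z)); apply: ID; last exact: IZ.
apply: low.
  by rewrite -scaleNr; apply: JD => //; apply/JZ/IJ.
have -> : y - c *: z = (y - c *: monomial W) - c *: (z - monomial W).
  by rewrite scalerBr opprB addrA subrK.
by apply/lspanB/lspanZ.
Qed.

(** In a chain that never stabilizes, new leading words keep appearing; by Dickson's lemma one of
    them is, up to permutation, an extension of an earlier one, so it was not new. *)
Lemma leading_acc (P : set R -> Prop) :
  (forall I, P I -> subspace I) ->
  (forall I W X, P I -> leading I W -> leading I (X ++ W)) -> acc P.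
Proof.
move=> Psub Pcat I PI Imono.
have Ile m m' : (m <= m')%N -> I m `<=` I m'.
  elim: m' => [|m' IHm']; first by rewrite leqn0 => /eqP->.
  by rewrite leq_eqVlt => /orP[/eqP->//|/IHm' mm']; exact: subset_trans (Imono m').
have leadI m m' W : (m <= m')%N -> leading (I m) W -> leading (I m') W.
  by move=> mm' [y Iy Wy]; exists y => //; exact: Ile Iy.
suff [m mP] : exists m, forall m' W, (m <= m')%N -> leading (I m') W -> leading (I m) W.
  exists m => m' mm'; apply/seteqP; split; last exact: Ile.
  by apply: leading_subset => [|||W]; [exact: Psub|exact: Psub|exact: Ile|exact: mP].
apply: contrapT => nostop.
(* [f m] is a later stage together with a leading word of that stage that is not one at stage
   [m]. *)
have /choice[f fP] m : exists q : nat * seq 'I_N,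
    [/\ (m <= q.1)%N, leading (I q.1) q.2 & ~ leading (I m) q.2].
  apply: contrapT => noq; apply: nostop; exists m => m' W mm' m'W.
  by apply: contrapT => mW; apply: noq; exists (m', W).
pose idx q := iter q (fun m => (f m).1) 0%N.
have idxS q : idx q.+1 = (f (idx q)).1 by [].
have idx_le : {homo idx : p q / (p <= q)%N}.
  apply: homo_leq => [//|? ? ?|q]; first exact: leq_trans.
  by rewrite idxS; have [] := fP (idx q).
have [p [q [X [pq XW]]]] := dickson (fun q => (f (idx q)).2).
have [_ leadW _] := fP (idx p); have [_ _] := fP (idx q); apply.
apply: (perm_leading (Psub _ (PI _)) XW); apply: (Pcat _ _ _ (PI _)).
(* The word chosen at step [p] is leading from stage [idx p.+1] on, hence at stage [idx q] because
   [p < q]. *)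
by apply: leadI leadW; rewrite -idxS; exact: idx_le.
Qed.

Lemma left_noetherian_monomials : left_noetherian R.
Proof.
apply: leading_acc => I.
  by case=> I0 ID IM; split=> // c y Iy; rewrite -[y]mul1r scalerAl; exact: IM.
move=> W X [_ _ IM] [y Iy Wy]; exists (monomial X * y); first exact: IM.
have := lower_mul X [::] Wy.
by rewrite cats0 [monomial [::]]big_nil mulr1 mulrBr monomial_cat.
Qed.

Lemma right_noetherian_monomials : right_noetherian R.
Proof.
have sub I : right_ideal I -> subspace I.
  by case=> I0 ID IM; split=> // c y Iy; rewrite -[y]mulr1 scalerAr; exact: IM.
apply: leading_acc => // I W X RI [y Iy Wy]; have [_ _ IM] := RI.
(* Right multiplication extends [W] on the other side; leading words are stable under
   permutation. *)
apply: (perm_leading (U := W ++ X)); [exact: sub|by rewrite perm_catC|].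
exists (y * monomial X); first exact: IM.
have := lower_mul [::] X Wy.
by rewrite [monomial [::]]big_nil mul1r mulrBl monomial_cat.
Qed.

End LeadingWords.

(** * Hard super-letters as skew-commuting generators *)

Section HardGenerators.
Variables (k : fieldType) (G : zmodType) (lam : G -> G -> k).
Hypothesis lam_bichar : bicharacter lam.
Variables (H : algType k) (n : nat) (a : 'I_n -> H) (g : 'I_n -> G) (d : 'I_n -> nat).
Hypothesis d_pos : forall i, (0 < d i)%N.
Hypothesis a_gen : generates_algebra a.
Hypothesis fin_hard : finite_set [set s : super_letter n | hard lam a g d s].

(** The underlying words are sorted lexicographically; as the order on super-letters is the reverse
    one, index 0 is the greatest super-letter. *)
Lemma hard_enumeration : exists (N : nat) (h : 'I_N -> super_letter n),
  (forall s, is_hard lam a g d s -> exists i, h i = s) /\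
  (forall i j : 'I_N, (i < j)%N -> sl_lt (h j) (h i)).
Proof.
have := finite_image (fun s : super_letter n => erase s) fin_hard.
case/finite_seqP => q0 q0E.
pose q : seq (seqlexi 'I_n) := sort <=%O (undup (q0 : seq (seqlexi 'I_n))).
have mem_q u : (u \in q) = (u \in q0) by rewrite mem_sort mem_undup.
have q_sorted : sorted <%O q by rewrite sort_lt_sorted undup_uniq.
have /choice[h hE] (i : 'I_(size q)) : exists s : super_letter n,
    erase s = nth [::] q i.
  have : (nth [::] q i : seq 'I_n) \in q0 by rewrite -mem_q mem_nth.
  have := congr1 (fun A : set (seq 'I_n) => A (nth [::] q i)) q0E => /= <-.
  by case=> s _ sE; exists s.
exists (size q), h; split=> [s /asboolP s_hard|i j ij].
  have sq : (erase s : seqlexi 'I_n) \in q.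
    rewrite mem_q; have := congr1 (fun A : set (seq 'I_n) => A (erase s)) q0E => /= <-.
    by exists s.
  have iq : (index (erase s : seqlexi 'I_n) q < size q)%N by rewrite index_mem.
  by exists (Ordinal iq); apply: super_letter_inj; rewrite hE /= nth_index.
by rewrite /sl_lt /word_lt !hE; apply: (sorted_ltn_nth (@lt_trans _ (seqlexi 'I_n)) [::] q_sorted); rewrite ?inE.
Qed.

Lemma noetherian_of_hard : left_noetherian H /\ right_noetherian H.
Proof.
have [N [h [h_onto h_lt]]] := hard_enumeration.
pose x i := skew_value lam a g (h i); pose delta i := sl_degree d (h i).
have delta_gt0 i : (0 < delta i)%N by exact: sl_degree_gt0.
have hard_monomial W : all (is_hard lam a g d) W -> exists X, W = map h X.
  elim: W => [|s W IHW] /=; first by exists [::].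
  by case/andP => /h_onto[i <-] /IHW[X ->]; exists (i :: X).
have monomialE X : sw_value lam a g (map h X) = monomial x X.
  by rewrite /sw_value big_map.
have weightE X : sw_degree d (map h X) = weight delta X.
  by rewrite /sw_degree big_map.
have x_gen y : lspan (monomials x predT) y.
  have letter_span (s : super_letter n) : lspan (monomials x predT) (skew_value lam a g s).
    have := hspan_letter lam a g d_pos s; apply: lspan_subset => _ [W [-> Wh _]].
    by have [X ->] := hard_monomial _ Wh; apply: sub_lspan; exists X.
  have letter_std i : standard_nonassoc (Letter i : nonassoc_word n).
    by split=> //; split=> // -[|? [|? ?]] // [|? ?].
  apply: (a_gen (S := lspan (monomials x predT))) => [|i]; last first.
    exact: (letter_span (SuperLetter (letter_std i))).
  split=> [|c u v|u v]; rewrite !inE.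
  - by apply: sub_lspan; exists [::]; rewrite // /monomial big_nil.
  - by move=> Su Sv; apply: lspanD => //; exact: lspanZ.
  apply: lspanM => _ _ [X _ ->] [Y _ ->]; apply: sub_lspan.
  by exists (X ++ Y); rewrite // monomial_cat.
have x_comm (i j : 'I_N) : (i < j)%N -> exists2 c : k, c != 0 &
    lspan (monomials x ((word_below delta)^~ [:: i; j])) (x i * x j - c *: (x j * x i)).
  move=> ij; exists (skew_coef lam g (erase (h i)) (erase (h j))).
    exact: skew_coef_neq0.
  have h_ij : erase (h i) <l erase (h j) := h_lt i j ij.
  have := skew_bracket_bspan lam_bichar a g (sl_standard (h i)) (sl_standard (h j)) h_ij.
  apply: lspan_subset => _ [W [-> Wij Wh]].
  have W_deg : sw_degree d W = weight delta [:: i; j].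
    rewrite sw_degree_erase (perm_word_degree d Wij) word_degree_cat.
    by rewrite /weight !big_cons big_nil addn0.
  (* Letters of [W] are at most the concatenation of the words of [h i] and [h j], which is strictly
     less than its beginning [h i]; reduction to hard letters keeps this bound in top degree. *)
  have : lspan (hard_words lam a g d (sw_degree d W) (fun s => sl_lt s (h i))) (sw_value lam a g W).
    apply: (hspan_sw (Q := fun s => sl_lt s (h i))) => [s si|].
      apply: hspan_sub (hspan_letter lam a g d_pos s) => t /= ts.
      exact: lt_le_trans si ts.
    apply: sub_all Wh => s; apply: lt_le_trans.
    by apply: lexi_lt_prefix; exact: erase_neq0.
  apply: lspan_subset => _ [W' [-> W'_hard W'_deg]].
  have [X W'X] := hard_monomial _ W'_hard; rewrite W'X monomialE in W'_deg *.
  apply: sub_lspan; exists X => //; apply/word_belowP.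
  rewrite weightE W_deg all_map in W'_deg.
  (* In equal degree, [X] has only letters of index above [i], whereas [[:: i; j]] contains [i]
     once; neither word has a letter of index below [i]. *)
  case: W'_deg => [|[X_deg Xi]]; [by left | right; split=> //; exists i].
  have X_gt (l : 'I_N) : l \in X -> (i < l)%N.
    move=> /(allP Xi) /= li; rewrite ltnNge; apply/negP.
    rewrite leq_eqVlt => /orP[/eqP/val_inj il|/h_lt il].
      by move: li; rewrite il /sl_lt /word_lt ltxx.
    by have := lt_trans il li; rewrite ltxx.
  have X0 (l : 'I_N) : (l <= i)%N -> count_mem l X = 0%N.
    by move=> li; apply/count_memPn/negP => /X_gt; rewrite ltnNge li.
  split; first by rewrite X0 //= eqxx.
  move=> l li; rewrite X0 ?(ltnW li) //= -!val_eqE /= !gtn_eqF //.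
  exact: ltn_trans ij.
split; [exact: left_noetherian_monomials delta_gt0 x_gen x_comm|].
exact: right_noetherian_monomials delta_gt0 x_gen x_comm.
Qed.

End HardGenerators.

Theorem corollary9 (k : fieldType) (G : zmodType) (lam : G -> G -> k)
    (lam_bichar : bicharacter lam)
    (H : algType k) (hopf : graded_hopf lam H)
    (n : nat) (a : 'I_n -> H) (g : 'I_n -> G) (d : 'I_n -> nat)
    (a_homog : forall i, component hopf (g i) (a i))
    (a_prim : forall i, primitive hopf (a i))
    (a_gen : generates_algebra a)
    (d_pos : forall i, (0 < d i)%N)
    (fin_hard : finite_set [set s : super_letter n | hard lam a g d s]) :
  left_noetherian H /\ right_noetherian H.
Proof. exact: noetherian_of_hard fin_hard. Qed.
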